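(* For all integers $n\ge1$ and $m\ge0$, the number of matchings on $[2n]$ that avoid the pattern $12312$ and have exactly $m$ crossings equals $$\sum_{i=n}^{2n-1}\frac{(-1)^{n+m+i}}{i}\binom{i}{n}\binom{3n}{i+1+n}\binom{i-n}{m}.$$
   Context: A matching on $[2n]$ is a partition of $[2n]$ into $n$ blocks of size two (edges), an edge written $(i,j)$ with $i<j$. Two edges $(i,j),(i',j')$ cross if $i<i'<j<j'$ or $i'<i<j'<j$; the number of crossings of a matching is the number of unordered pairs of its edges that cross. The canonical sequential form of a matching with $n$ edges is the word of length $2n$ obtained by labeling edges $1,\dots,n$ in increasing order of initial points and writing at each position the label of the edge containing it. Words $a_1\cdots a_k$, $b_1\cdots b_k$ are order-isomorphic if $a_i<a_j\iff b_i<b_j$ for all $i,j$. A matching contains a pattern $\tau$ if its canonical sequential form has a subsequence order-isomorphic to $\tau$, and avoids $\tau$ otherwise. *)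

(* Defs.v *)
From HB Require Import structures.
From mathcomp Require Import all_boot all_order all_algebra.
Set Implicit Arguments.
Unset Strict Implicit.
Unset Printing Implicit Defensive.

(* The ground set [2n] is 'I_(2 * n), i.e. {0, ..., 2n - 1}: positions are
   shifted by one, which affects neither crossings nor canonical forms. *)
Definition is_matching (n : nat) (M : {set {set 'I_(2 * n)}}) : bool :=
  [&& partition M [set: 'I_(2 * n)], #|M| == n & [forall B in M, #|B| == 2]].

Definition edges (n : nat) (M : {set {set 'I_(2 * n)}}) :
    {set 'I_(2 * n) * 'I_(2 * n)} :=
  [set e : 'I_(2 * n) * 'I_(2 * n) | (e.1 < e.2) && ([set e.1; e.2] \in M)].

Definition cross (N : nat) (e f : 'I_N * 'I_N) : bool :=
  [&& e.1 < f.1, f.1 < e.2 & e.2 < f.2] || [&& f.1 < e.1, e.1 < f.2 & f.2 < e.2].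

(* Unordered pairs of edges are two-element sets; cross e f forces e != f. *)
Definition crossings (n : nat) (M : {set {set 'I_(2 * n)}}) : nat :=
  #|[set [set e; f] | e in edges M, f in edges M & cross e f]|.

(* The rank (from 1 to n) of f when edges are sorted by initial point. *)
Definition edge_label (n : nat) (M : {set {set 'I_(2 * n)}})
    (f : 'I_(2 * n) * 'I_(2 * n)) : nat :=
  #|[set e in edges M | e.1 <= f.1]|.

(* The default 0 is never used when M is a matching. *)
Definition label_at (n : nat) (M : {set {set 'I_(2 * n)}}) (p : 'I_(2 * n)) : nat :=
  oapp (edge_label M) 0 [pick f in edges M | (p == f.1) || (p == f.2)].

Definition canonical_form (n : nat) (M : {set {set 'I_(2 * n)}}) : seq nat :=
  [seq label_at M p | p <- enum 'I_(2 * n)].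

Definition order_iso (a b : seq nat) : bool :=
  (size a == size b) &&
  [forall i : 'I_(size a), forall j : 'I_(size a),
     (nth 0 a i < nth 0 a j) == (nth 0 b i < nth 0 b j)].

(* Subsequences are given by masks, to keep containment boolean. *)
Definition word_contains (w t : seq nat) : bool :=
  [exists b : (size w).-tuple bool, order_iso (mask b w) t].

Lemma word_containsP (w t : seq nat) :
  reflect (exists2 s : seq nat, subseq s w & order_iso s t) (word_contains w t).
Proof.
apply: (iffP existsP) => [[b bt]|[s /subseqP[b /eqP sb ->] st]].
  by exists (mask b w) => //; exact: mask_subseq.
by exists (Tuple sb).
Qed.

Definition avoids (n : nat) (M : {set {set 'I_(2 * n)}}) (t : seq nat) : bool :=
  ~~ word_contains (canonical_form M) t.

(* Main.v *)
Require Import Defs.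
From HB Require Import structures.
From mathcomp Require Import all_boot all_order all_algebra.
From mathcomp Require Import ring zify.
Set Implicit Arguments.
Unset Strict Implicit.
Unset Printing Implicit Defensive.
Import Order.TTheory GRing.Theory Num.Theory.

(* Read a matching from left to right, keeping the stack of open edges. Closing
   an edge crosses exactly the open edges above it in the stack, and 12312 is
   avoided iff every such crossed edge is the most recently opened one. So each
   closing step takes the top of the stack (no crossing), or, when the top is
   the most recently opened edge, the entry just below it (one crossing).

   Let S_h be the generating function, in q for crossings and x for opened
   edges, of the histories ending with h open edges, and B_h that of those whose
   most recently opened edge is still open. Then B_0 = 0, S_0 = 1 + S_1,
     S_h = S_(h+1) + B_h   and   B_h = x S_(h-1) + q B_(h+1)   for h > 0,
   which is solved by S_h = t^h (1 + t)^(1 - h), where t is the power series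
   with t (1 - (q - 1) t) = x (1 + t)^3. Lagrange inversion predicts the
   coefficients of S_h and B_h; these closed forms are checked against the
   recurrences, and h = 0 gives the theorem. *)

(** * Sequences and finite sets *)

Lemma index_rev_sorted s a : sorted ltn s -> a \in s ->
  index a (rev s) = count (ltn a) s.
Proof.
rewrite (sorted_pairwise ltn_trans).
elim/last_ind: s => // s x IH.
rewrite pairwise_rcons mem_rcons inE rev_rcons /=.
case/andP => /allP s_lt s_pw; rewrite -cats1 count_cat /= addn0 [x == a]eq_sym.
case: eqP => [->|_] /= a_in; last by rewrite (s_lt a a_in) addn1 IH.
rewrite ltnn addn0; apply/esym/eqP; rewrite eqn0Ngt -has_count.
by apply/hasPn => b /s_lt /= bx; rewrite -leqNgt ltnW.
Qed.

Fixpoint partner (T : eqType) (E : seq (T * T)) (x : T) : T :=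
  if E is (a, b) :: E' then
    if x == a then b else if x == b then a else partner E' x
  else x.

Lemma partnerP (T : eqType) (E : seq (T * T)) (x y : T) :
  uniq (unzip1 E ++ unzip2 E) -> (x, y) \in E ->
  partner E x = y /\ partner E y = x.
Proof.
elim: E => //= -[a b] E IH; rewrite mem_cat inE !negb_or cat_uniq /=.
case/and5P => /and3P[aE1 ab aE2] E1_uniq /norP[bE1 disj] bE2 E2_uniq.
rewrite inE => /predU1P[[-> ->]|xyE].
  by rewrite !eqxx eq_sym (negPf ab).
have xE1 : x \in unzip1 E by apply/mapP; exists (x, y).
have yE2 : y \in unzip2 E by apply/mapP; exists (x, y).
rewrite (negPf (memPn aE1 _ xE1)) (negPf (memPn bE1 _ xE1)).
rewrite (negPf (memPn aE2 _ yE2)) (negPf (memPn bE2 _ yE2)).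
by apply: IH; rewrite // cat_uniq E1_uniq disj.
Qed.

Lemma set2_inj (T : finType) (x y x' y' : T) : [set x; y] = [set x'; y'] ->
  (x = x' /\ y = y') \/ (x = y' /\ y = x').
Proof.
move=> eq_xy; have := set21 x y; have := set22 x y.
have := set21 x' y'; have := set22 x' y'; rewrite -eq_xy {3 4}eq_xy !inE.
by do 4![case/pred2P => ?]; subst; tauto.
Qed.

Lemma card_unordered_pairs (T : finType) (A : {set T}) (r : rel T) :
  (forall x y, r x y -> ~~ r y x) ->
  #|[set [set x; y] | x in A, y in A & r x y || r y x]| =
  \sum_(x in A) \sum_(y in A | r x y) 1.
Proof.
move=> asym; rewrite pair_big_dep sum1_card.
rewrite -(@card_in_imset _ _ (fun xy : T * T => [set xy.1; xy.2])).
  apply: eq_card => Z; apply/imset2P/imsetP => [[x y xA]|[[x y]]].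
    rewrite inE => /andP[yA /orP[rxy|ryx]] ->.
      by exists (x, y); rewrite // unfold_in /= xA yA.
    by exists (y, x); rewrite 1?setUC // unfold_in /= xA yA.
  rewrite unfold_in /= => /and3P[xA yA rxy] ->; exists x y => //.
  by rewrite inE yA rxy.
move=> [x y] [x' y']; rewrite !unfold_in /=.
move=> /and3P[_ _ rxy] /and3P[_ _ rx'y'].
case/set2_inj => -[xE yE]; first by rewrite xE yE.
by move: (asym _ _ rxy); rewrite xE yE rx'y'.
Qed.

Lemma partition_involution (T : finType) (f : T -> T) : involutive f ->
  partition [set [set x; f x] | x : T] [set: T].
Proof.
move=> fK; have block x y : x \in [set y; f y] -> [set x; f x] = [set y; f y].
  by rewrite !inE => /pred2P[]->; rewrite // fK setUC.
apply/and3P; split.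
- apply/eqP/setP => x; rewrite inE; apply/bigcupP.
  by exists [set x; f x]; [exact: imset_f | exact: set21].
- apply/trivIsetP => _ _ /imsetP[x _ ->] /imsetP[y _ ->]; apply: contraNT.
  by case/pred0Pn => z /andP[/block <- /block <-].
by apply/imsetP => -[x _ /setP/(_ x)]; rewrite !inE eqxx.
Qed.

(** * Patterns in words *)

Definition increasing (N : nat) (s : seq 'I_N) : bool :=
  sorted (fun i j : 'I_N => i < j) s.

Lemma increasing_enum N : increasing (enum 'I_N).
Proof. by have := iota_ltn_sorted 0 N; rewrite -val_enum_ord sorted_map. Qed.

Lemma increasing_subseq_enum N (s : seq 'I_N) :
  increasing s = subseq s (enum 'I_N).
Proof.
have lt_trans : transitive (fun i j : 'I_N => i < j).
  by move=> ? ? ?; exact: ltn_trans.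
apply/idP/idP => [s_incr|/(subseq_sorted lt_trans)]; last first.
  by apply; exact: increasing_enum.
rewrite (_ : s = [seq i <- enum 'I_N | i \in s]) ?filter_subseq //.
apply: (irr_sorted_eq lt_trans) => //; first by move=> i /=; rewrite ltnn.
  exact: sorted_filter (increasing_enum N).
by move=> i; rewrite mem_filter mem_enum andbT.
Qed.

Lemma order_isoP (a b : seq nat) :
  reflect (size a = size b /\ forall i j, i < size a -> j < size a ->
             (nth 0 a i < nth 0 a j) = (nth 0 b i < nth 0 b j))
          (order_iso a b).
Proof.
apply: (iffP andP) => -[/eqP szab iso]; split=> //.
  move=> i j ia ja.
  by have /forallP/(_ (Ordinal ja))/eqP := forallP iso (Ordinal ia).
by apply/forallP => i; apply/forallP => j; rewrite iso.
Qed.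

Lemma order_iso_map (T : Type) (f g : T -> nat) (s : seq T) (t : seq nat) :
  (forall x y, (f x < f y) = (g x < g y)) ->
  order_iso (map f s) t = order_iso (map g s) t.
Proof.
move=> fg; have fg_nth i j : i < size s -> j < size s ->
    (nth 0 (map f s) i < nth 0 (map f s) j)
    = (nth 0 (map g s) i < nth 0 (map g s) j).
  by case: s => // x0 s il jl; rewrite !(nth_map x0) // fg.
by apply/order_isoP/order_isoP; rewrite !size_map => -[szt iso];
  split=> // i j il jl; rewrite -iso ?fg_nth.
Qed.

Lemma order_iso_12312 a b c d e :
  order_iso [:: a; b; c; d; e] [:: 1; 2; 3; 1; 2] =
  [&& a < b, b < c, d == a & e == b].
Proof.
apply/order_isoP/and4P => [[_ iso]|[ab bc /eqP-> /eqP->]].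
  have [/= -> ->] := (iso 0 1 isT isT, iso 1 2 isT isT).
  have [/= ad da] := (iso 0 3 isT isT, iso 3 0 isT isT).
  by have [/= be eb] := (iso 1 4 isT isT, iso 4 1 isT isT); split=> //; lia.
by split=> // -[|[|[|[|[|//]]]]] [|[|[|[|[|//]]]]] _ _ /=; lia.
Qed.

Lemma word_contains_enumP N (f : 'I_N -> nat) (t : seq nat) :
  reflect (exists2 s : seq 'I_N, increasing s & order_iso (map f s) t)
          (word_contains (map f (enum 'I_N)) t).
Proof.
apply: (iffP (word_containsP _ _)) => -[s].
  case/subseqP => b _ ->; rewrite -map_mask => iso.
  by exists (mask b (enum 'I_N)); rewrite ?increasing_subseq_enum ?mask_subseq.
rewrite increasing_subseq_enum => s_sub iso; exists (map f s) => //.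
exact: map_subseq.
Qed.

(** * Codes of matchings *)

(* The entry of the newest point comes first; [None] stands for an initial
   point, [Some a] for the terminal point of the edge starting at [a]. *)
Definition code := seq (option nat).

Fixpoint stack (v : code) : seq nat :=
  match v with
  | [::] => [::]
  | None :: v' => size v' :: stack v'
  | Some a :: v' => rem a (stack v')
  end.

Definition height (v : code) : nat := size (stack v).

Fixpoint valid (v : code) : bool :=
  match v with
  | [::] => true
  | None :: v' => valid v'
  | Some a :: v' => (a \in stack v') && valid v'
  end.

(* Is the most recently opened edge still open? *)
Fixpoint fresh (v : code) : bool :=
  match v with
  | [::] => false
  | None :: _ => true
  | Some a :: v' => fresh v' && (0 < index a (stack v'))
  end.

Fixpoint ncross (v : code) : nat :=
  match v with
  | [::] => 0
  | None :: v' => ncross v'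
  | Some a :: v' => index a (stack v') + ncross v'
  end.

Fixpoint avoiding (v : code) : bool :=
  match v with
  | [::] => true
  | None :: v' => avoiding v'
  | Some a :: v' => (index a (stack v') <= fresh v') && avoiding v'
  end.

Definition extensions (v : code) : seq code :=
  (None :: v) :: [seq Some a :: v | a <- take (fresh v).+1 (stack v)].

Fixpoint avoiding_codes (p : nat) : seq code :=
  if p is p'.+1 then flatten [seq extensions v | v <- avoiding_codes p']
  else [:: [::]].

Lemma stack_lt_size v i : i \in stack v -> i < size v.
Proof.
elim: v => //= -[a|] v IH /=; first by move/mem_rem/IH/ltnW.
by rewrite inE => /predU1P[->|/IH/ltnW].
Qed.

Lemma stack_uniq v : uniq (stack v).
Proof.
elim: v => //= -[a|] v IH /=; first exact: rem_uniq.
by rewrite IH andbT; apply/negP => /stack_lt_size; rewrite ltnn.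
Qed.

Lemma height_le_size v : height v <= size v.
Proof.
rewrite /height; elim: v => //= -[a|] v IH //=; apply: leq_trans (leqW IH).
by rewrite size_subseq // rem_subseq.
Qed.

Lemma mem_extensions x v u :
  (x :: v \in extensions u) = (v == u) &&
    (if x is Some a then (a \in stack v) && (index a (stack v) <= fresh v)
     else true).
Proof.
rewrite inE; case: x => [a|] /=; last first.
  rewrite eqseq_cons eqxx; case: eqP => //= _; apply/negbTE.
  by apply/mapP => -[].
apply/mapP/andP => [[b b_in [-> ->]]|[/eqP <- /andP[a_in ia]]].
  by have s_in := mem_take b_in; rewrite s_in -ltnS -in_take.
by exists a; rewrite // in_take // ltnS.
Qed.

Lemma extensions_uniq v : uniq (extensions v).
Proof.
rewrite /= map_inj_uniq ?take_uniq ?stack_uniq //; last by move=> a b [].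
by rewrite andbT; apply/mapP => -[].
Qed.

Lemma avoiding_codesP p v :
  (v \in avoiding_codes p) = [&& size v == p, valid v & avoiding v].
Proof.
elim: p v => [|p IH] [|x v]; rewrite ?inE //=.
  by apply/flatten_mapP => -[u _]; rewrite inE => /mapP[].
apply/flatten_mapP/and3P => [[u]|[/eqP[szv] vxv axv]].
  rewrite IH mem_extensions => /and3P[szu vu au] /andP[/eqP -> x_ok].
  by rewrite eqSS szu; case: x x_ok => [a /andP[-> ->]|_].
exists v; first rewrite IH szv eqxx.
  by case: x vxv axv => [a /andP[_ ->] /andP[_ ->]|-> ->].
rewrite mem_extensions eqxx.
by case: x vxv axv => // a /andP[-> _] /andP[-> _].
Qed.

Lemma avoiding_codes_uniq p : uniq (avoiding_codes p).
Proof.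
elim: p => //= p IH; elim: (avoiding_codes p) IH => // v s IHs /andP[vs us].
rewrite -[flatten _]/(extensions v ++ flatten (map extensions s)).
rewrite cat_uniq extensions_uniq IHs // andbT.
apply/hasPn => -[|x u] /flatten_mapP[w ws] w_ext; first by apply/mapP => -[].
by apply: contra vs; move: w_ext; rewrite !mem_extensions;
  case/andP => /eqP -> _ /andP[/eqP <-].
Qed.

(** * Fixed-point-free involutions and their codes *)

Definition fpf_involution (N : nat) (g : nat -> nat) : Prop :=
  forall i, i < N -> [/\ g i < N, g (g i) = i & g i != i].

Definition code_of (g : nat -> nat) (p : nat) : code :=
  rev (mkseq (fun i => if g i < i then Some (g i) else None) p).

Lemma code_ofS g p : code_of g p.+1 =
  (if g p < p then Some (g p) else None) :: code_of g p.
Proof. by rewrite /code_of mkseqS rev_rcons. Qed.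

Lemma size_code_of g p : size (code_of g p) = p.
Proof. by rewrite size_rev size_mkseq. Qed.

(* Initial points of the edges that cross the edge ending at [q] and end after
   it. *)
Definition crossed (g : nat -> nat) (q : nat) : seq nat :=
  [seq b <- iota 0 q | (g q < b) && (q < g b)].

Definition latest_opener (g : nat -> nat) (p o : nat) : Prop :=
  [/\ o < p, o < g o & forall x, o < x < p -> g x < x].

Lemma mem_crossed g q b : (b \in crossed g q) = (g q < b < q) && (q < g b).
Proof. by rewrite mem_filter mem_iota add0n leq0n andbAC. Qed.

Lemma crossed_uniq g q : uniq (crossed g q).
Proof. by rewrite filter_uniq ?iota_uniq. Qed.

Lemma latest_opener_unique g p o o' :
  latest_opener g p o -> latest_opener g p o' -> o = o'.
Proof.
move=> [op oo after_o] [o'p oo' after_o']; have := after_o o'.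
by have := after_o' o; lia.
Qed.

Lemma latest_openerS g p o : g p < p ->
  latest_opener g p.+1 o <-> latest_opener g p o.
Proof.
move=> gp; split=> -[op oo after_o]; split=> //; last 2 first.
- exact: ltnW.
- move=> x /andP[ox]; rewrite ltnS leq_eqVlt => /predU1P[->//|xp].
  by apply: after_o; rewrite ox.
- rewrite ltn_neqAle -ltnS op andbT; apply: contraTneq oo => ->.
  by rewrite -leqNgt ltnW.
by move=> x /andP[ox xp]; apply: after_o; rewrite ox ltnW.
Qed.

Lemma crossed_latest_opener g q b : b \in crossed g q ->
  (forall c, b < c < q -> g c < c) -> latest_opener g q b.
Proof.
rewrite mem_crossed => /andP[/andP[_ bq] qgb] after_b.
by split=> //; exact: ltn_trans qgb.
Qed.

Section CodeOf.

Variables (N : nat) (g : nat -> nat).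
Hypothesis g_inv : fpf_involution N g.

Lemma stack_code_of p : p <= N ->
  stack (code_of g p) = rev [seq i <- iota 0 p | p <= g i].
Proof.
elim: p => // p IH pN; have [_ ggp gpp] := g_inv pN.
rewrite code_ofS -[in iota 0 _]addn1 iotaD filter_cat rev_cat /= add0n.
have eq_partner i : i \in iota 0 p -> (p == g i) = (i == g p).
  rewrite mem_iota => /andP[_ ip]; have [_ ggi _] := g_inv (ltn_trans ip pN).
  by apply/eqP/eqP => [->|->].
case: ltnP => gp /=; rewrite IH ?(ltnW pN) ?size_code_of //; last first.
  rewrite ltn_neqAle eq_sym gpp gp; congr (_ :: rev _).
  apply: eq_in_filter => i i_in; rewrite [p < _]ltn_neqAle eq_partner //.
  move: i_in; rewrite mem_iota => /andP[_ ip].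
  by rewrite ltn_eqF // (leq_trans ip).
rewrite [p < g p]ltnNge (ltnW gp) /= rem_filter; last first.
  by rewrite rev_uniq filter_uniq ?iota_uniq.
rewrite filter_rev -filter_predI; congr rev; apply: eq_in_filter => i i_in /=.
by rewrite [RHS]ltn_neqAle eq_partner.
Qed.

Lemma valid_code_of p : p <= N -> valid (code_of g p).
Proof.
elim: p => // p IH pN; have [_ ggp _] := g_inv pN; rewrite code_ofS.
case: ltnP => gp /=; rewrite IH ?(ltnW pN) // andbT.
rewrite stack_code_of ?(ltnW pN) //.
by rewrite mem_rev mem_filter ggp leqnn mem_iota.
Qed.

Lemma stack_code_of_full : stack (code_of g N) = [::].
Proof.
rewrite stack_code_of // (eq_in_filter (a2 := pred0)) ?filter_pred0 // => i.
by rewrite mem_iota => /andP[_ /g_inv[giN _ _]]; rewrite leqNgt giN.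
Qed.

Lemma index_code_of q : q < N -> g q < q ->
  index (g q) (stack (code_of g q)) = size (crossed g q).
Proof.
move=> qN gq; have [_ ggq _] := g_inv qN; rewrite stack_code_of ?(ltnW qN) //.
rewrite index_rev_sorted; first last.
- by rewrite mem_filter mem_iota ggq leqnn.
- by apply: sorted_filter (iota_ltn_sorted 0 q) => ? ? ?; exact: ltn_trans.
rewrite count_filter size_filter; apply: eq_in_count => b.
rewrite mem_iota => bq /=.
have [_ ggb _] := g_inv (ltn_trans bq qN).
apply: andb_id2l => gqb; rewrite leq_eqVlt orb_idl // => /eqP qE.
by rewrite -[b]ggb -qE ltnn in gqb.
Qed.

Lemma fresh_code_of p : p <= N ->
  fresh (code_of g p) <-> exists2 o, latest_opener g p o & p <= g o.
Proof.
elim: p => [|p IH] pN; first by split=> // -[o []].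
have [_ ggp gpp] := g_inv pN; rewrite code_ofS; case: ltnP => gp /=; last first.
  have pgp : p < g p by rewrite ltn_neqAle eq_sym gpp.
  by split=> // _; exists p; rewrite //; split=> // x; lia.
rewrite index_code_of // -has_predT; split.
  case/andP => /(IH (ltnW pN))[o latest_o pgo] /hasP[b].
  rewrite mem_crossed => /andP[/andP[gpb bp] pgb] _.
  exists o; first exact/latest_openerS.
  rewrite ltn_neqAle pgo andbT; apply/eqP => pE.
  have [op _ after_o] := latest_o; have [_ ggo _] := g_inv (ltn_trans op pN).
  by have := after_o b; rewrite -ggo -pE gpb bp => /(_ isT); lia.
case=> o /(latest_openerS _ gp) latest_o pgo; have [op _ after_o] := latest_o.
apply/andP; split; first by apply/(IH (ltnW pN)); exists o; rewrite // ltnW.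
apply/hasP; exists o; rewrite // mem_crossed op pgo !andbT.
rewrite ltnNge leq_eqVlt; apply/negP => /predU1P[oE|ogp].
  by rewrite oE ggp ltnn in pgo.
by have := after_o (g p); rewrite ogp gp ggp => /(_ isT); lia.
Qed.

Lemma latest_opener_crossed q o : q < N -> g q < o -> latest_opener g q o ->
  q <= g o -> o \in crossed g q.
Proof.
move=> qN gqo [oq _ _] qgo; rewrite mem_crossed gqo oq /= ltn_neqAle qgo andbT.
have [_ ggo _] := g_inv (ltn_trans oq qN).
by apply: contraTneq gqo => ->; rewrite ggo ltnn.
Qed.

(* The edge starting at [c] would be the 3 of a 12312 whose 1 and 2 are the
   edges ending at [q] and starting at [b]. *)
Lemma closing_avoiding q : q < N -> g q < q ->
  index (g q) (stack (code_of g q)) <= fresh (code_of g q) <->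
  (forall b c, b \in crossed g q -> b < c < q -> g c < c).
Proof.
move=> qN gq; rewrite index_code_of //; have freshP := fresh_code_of (ltnW qN).
split=> [size_le b c b_in /andP[bc cq]|avoid].
  have is_fresh : fresh (code_of g q).
    case: (fresh _) size_le => //; rewrite leqn0 => /nilP E.
    by rewrite E in b_in.
  have [o latest_o qgo] := freshP.1 is_fresh; have [_ _ after_o] := latest_o.
  have [co|oc] := leqP c o; last by apply: after_o; rewrite oc.
  move: (b_in); rewrite mem_crossed => /andP[/andP[gqb _] _].
  have gqo : g q < o by lia.
  have o_in := latest_opener_crossed qN gqo latest_o qgo.
  have bo : uniq [:: b; o] by rewrite /= andbT inE; lia.
  suff : 1 < size (crossed g q) by move: size_le; rewrite is_fresh; lia.
  by apply: (uniq_leq_size bo) => x; rewrite !inE => /orP[]/eqP->.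
have latest x (x_in : x \in crossed g q) : latest_opener g q x.
  by apply: (crossed_latest_opener x_in) => c; exact: avoid.
case E: (crossed g q) => [//|b s]; rewrite -E.
have b_in : b \in crossed g q by rewrite E mem_head.
have -> : fresh (code_of g q).
  apply/freshP; exists b; first exact: latest.
  by move: b_in; rewrite mem_crossed => /andP[_ /ltnW].
apply: (uniq_leq_size (s2 := [:: b])) (crossed_uniq g q) _ => x x_in.
by rewrite inE (latest_opener_unique (latest x x_in) (latest b b_in)).
Qed.

Lemma avoiding_code_of p : p <= N ->
  avoiding (code_of g p) <->
  (forall q b c, q < p -> b \in crossed g q -> b < c < q -> g c < c).
Proof.
elim: p => [|p IH] pN; first by split.
have {}IH := IH (ltnW pN).
have avoidingS : avoiding (code_of g p.+1) <-> avoiding (code_of g p) /\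
    (forall b c, b \in crossed g p -> b < c < p -> g c < c).
  rewrite code_ofS; case: ltnP => gp /=; last first.
    by split=> [|[]//]; split=> // b c; rewrite mem_crossed; lia.
  split=> [/andP[i_le ->]|[-> avoid]].
    by split=> //; apply/closing_avoiding.
  by rewrite andbT; apply/closing_avoiding.
split=> [/avoidingS[/IH avoid avoid_last] q b c|avoid].
  rewrite ltnS leq_eqVlt => /predU1P[->|]; last exact: avoid.
  exact: avoid_last.
apply/avoidingS; split=> [|b c]; last exact: avoid.
by apply/IH => q b c qp; apply: avoid; exact: ltnW.
Qed.

Lemma ncross_code_of p : p <= N ->
  ncross (code_of g p) = \sum_(q < p | g q < q) size (crossed g q).
Proof.
elim: p => [|p IH] pN; first by rewrite big_ord0.
rewrite code_ofS big_mkcond big_ord_recr /= -big_mkcond /= -(IH (ltnW pN)).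
by case: ifP => gp /=; rewrite ?addn0 // index_code_of // addnC.
Qed.

End CodeOf.

Lemma code_of_inj N g g' : fpf_involution N g -> fpf_involution N g' ->
  code_of g N = code_of g' N -> forall i, i < N -> g i = g' i.
Proof.
move=> gI g'I /(can_inj revK) eq_codes.
have closer q : q < N -> g q < q -> g' q = g q.
  move=> qN gq; have /(congr1 (nth None ^~ q)) := eq_codes.
  by rewrite !nth_mkseq // gq; case: ifP => // _ [].
move=> i iN; have [giN ggi gii] := gI _ iN.
have [lt|ge] := ltnP (g i) i; first by rewrite closer.
have := closer _ giN; rewrite ggi ltn_neqAle eq_sym gii ge => /(_ isT) g'gi.
by have [_ + _] := g'I _ giN; rewrite g'gi.
Qed.

Fixpoint arcs (v : code) : seq (nat * nat) :=
  match v with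
  | [::] => [::]
  | None :: v' => arcs v'
  | Some a :: v' => (a, size v') :: arcs v'
  end.

Lemma arcs_lt v e : valid v -> e \in arcs v -> e.1 < e.2.
Proof.
elim: v => //= -[a|] v IH //= /andP[/stack_lt_size av /IH{}IH].
by rewrite inE => /predU1P[->|/IH].
Qed.

Lemma arcs_lt_size v e : e \in arcs v -> e.2 < size v.
Proof.
elim: v => //= -[a|] v IH; last by move/IH/ltnW.
by rewrite inE => /predU1P[->//|/IH/ltnW].
Qed.

Lemma perm_arcs v : valid v ->
  perm_eq (stack v ++ unzip1 (arcs v) ++ unzip2 (arcs v)) (iota 0 (size v)).
Proof.
have iotaS p : iota 0 p.+1 = iota 0 p ++ [:: p] by rewrite -addn1 iotaD.
elim: v => // -[a|] v IH; rewrite [size _]/= iotaS /= => v_valid.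
  have [a_in /IH/permP v_perm] := andP v_valid; apply/permP => P.
  have := v_perm P; have /permP/(_ P) := perm_to_rem a_in.
  by rewrite /= !count_cat /= !count_cat /=; lia.
have /permP v_perm := IH v_valid; apply/permP => P; have := v_perm P.
by rewrite /= !count_cat /=; lia.
Qed.

Lemma nth_rev_arcs v i a :
  (nth None (rev v) i == Some a) = ((a, i) \in arcs v).
Proof.
elim: v => [|x v IH]; first by rewrite nth_nil.
rewrite rev_cons nth_rcons size_rev; case: ltngtP => [iv|vi|->].
- by rewrite IH; case: x => [b|] //=; rewrite inE xpair_eqE (ltn_eqF iv) andbF.
- by apply/esym/negbTE/negP => /arcs_lt_size /=; rewrite ltnS leqNgt vi.
have notin : (a, size v) \notin arcs v.
  by apply/negP => /arcs_lt_size; rewrite ltnn.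
case: x => [b|] /=; last by rewrite (negPf notin).
by rewrite inE xpair_eqE eqxx andbT (negPf notin) orbF eq_sym.
Qed.

Section ClosedCode.

Variable v : code.
Hypotheses (v_valid : valid v) (v_closed : stack v = [::]).

Lemma arcs_partnerE a b : (a, b) \in arcs v ->
  [/\ a < b, b < size v, partner (arcs v) a = b & partner (arcs v) b = a].
Proof.
have v_perm := perm_arcs v_valid; rewrite v_closed /= in v_perm => e_in.
have [|pa pb] := partnerP _ e_in; first by rewrite (perm_uniq v_perm) iota_uniq.
by split; rewrite // ?(arcs_lt v_valid e_in) ?(arcs_lt_size e_in).
Qed.

Lemma arcs_cover i : i < size v ->
  (exists b, (i, b) \in arcs v) \/ (exists a, (a, i) \in arcs v).
Proof.
move=> iv; have : i \in iota 0 (size v) by rewrite mem_iota.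
rewrite -(perm_mem (perm_arcs v_valid)) v_closed /= mem_cat.
case/orP => /mapP[[a b] e_in ->] /=.
  by left; exists b.
by right; exists a.
Qed.

Lemma partner_fpf_involution : fpf_involution (size v) (partner (arcs v)).
Proof.
move=> i /arcs_cover[][j /arcs_partnerE].
  by case=> ij jv -> ->; rewrite gtn_eqF.
by case=> ji iv pj ->; rewrite pj ltn_eqF // (ltn_trans ji).
Qed.

Lemma code_of_partner : code_of (partner (arcs v)) (size v) = v.
Proof.
apply: (canLR revK); apply: (@eq_from_nth _ None).
  by rewrite size_mkseq size_rev.
move=> i; rewrite size_mkseq => iv; rewrite nth_mkseq //.
case: (arcs_cover iv) => -[j ij_in].
  have [ij _ pi _] := arcs_partnerE ij_in; rewrite pi ltnNge (ltnW ij) /=.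
  case E: (nth _ _ _) => [a|//]; move/eqP: E.
  by rewrite nth_rev_arcs => /arcs_partnerE[ai _ _]; rewrite pi => ja; lia.
have [ji _ _ pi] := arcs_partnerE ij_in; rewrite pi ji; apply/esym/eqP.
by rewrite nth_rev_arcs.
Qed.

End ClosedCode.

(** * Matchings on [2n] *)

Section Matching.

Variable n : nat.
Local Notation N := (2 * n).
Implicit Types (M : {set {set 'I_N}}) (i j p q : 'I_N).

Definition mate M i : 'I_N :=
  odflt i [pick j | (j != i) && ([set i; j] \in M)].

Definition mate_nat M (k : nat) : nat :=
  if insub k is Some i then val (mate M i) else k.

Definition matching_code M : code := code_of (mate_nat M) N.

Lemma mate_natE M i : mate_nat M i = mate M i.
Proof. by rewrite /mate_nat valK. Qed.

Lemma mateP M i : is_matching M -> mate M i != i /\ [set i; mate M i] \in M.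
Proof.
case/and3P => /and3P[/eqP cov _ _] _ /forallP sz2.
rewrite /mate; case: pickP => [j /andP[]|no] //=.
have : i \in cover M by rewrite cov inE.
case/bigcupP => B BM iB.
have := sz2 B; rewrite BM /= => /cards2P[x [y [xy BE]]].
move: no iB BM; rewrite BE !inE => + /orP[]/eqP iE BM; rewrite iE => no.
  by have := no y; rewrite eq_sym xy BM.
by have := no x; rewrite xy setUC BM.
Qed.

Lemma mate_unique M i j : is_matching M -> j != i -> [set i; j] \in M ->
  mate M i = j.
Proof.
move=> Mm ji ijM; have [mi miM] := mateP i Mm.
case/and3P: Mm => /and3P[_ triv _] _ _.
have block B : B \in M -> i \in B -> pblock M i = B by exact: def_pblock.
have : [set i; j] = [set i; mate M i].
  by rewrite -(block _ ijM) ?(block _ miM) ?set21.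
by case/set2_inj => -[// _ jE]; rewrite jE eqxx in ji.
Qed.

Lemma mateK M : is_matching M -> involutive (mate M).
Proof.
move=> Mm i; have [mi miM] := mateP i Mm.
by apply: mate_unique => //; rewrite 1?eq_sym // setUC.
Qed.

Lemma mate_nat_fpf_involution M : is_matching M ->
  fpf_involution N (mate_nat M).
Proof.
move=> Mm k kN; rewrite -[k]/(val (Ordinal kN)) !mate_natE mateK //.
by split=> //; case: (mateP (Ordinal kN) Mm).
Qed.

Lemma matching_mate M : is_matching M ->
  M = [set [set i; mate M i] | i : 'I_N].
Proof.
move=> Mm; apply/setP => B; apply/idP/imsetP => [BM|[i _ ->]]; last first.
  by case: (mateP i Mm).
case/and3P: (Mm) => _ _ /forallP/(_ B); rewrite BM => /cards2P[x [y [xy BE]]].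
exists x => //; rewrite BE (mate_unique _ _ (_ : [set x; y] \in M)) -?BE //.
by rewrite eq_sym.
Qed.

Lemma exists_matching (g : nat -> nat) : fpf_involution N g ->
  exists2 M : {set {set 'I_N}},
    is_matching M & forall k, k < N -> mate_nat M k = g k.
Proof.
move=> gI; have gN i : g i < N by case: (gI i (ltn_ord i)).
pose G i := Ordinal (gN i).
have GK : involutive G by move=> i; apply/val_inj; case: (gI i (ltn_ord i)).
have Gn i : G i != i by rewrite -val_eqE; case: (gI i (ltn_ord i)).
pose M := [set [set i; G i] | i : 'I_N].
have M_part : partition M [set: 'I_N] := partition_involution GK.
have M_card2 B : B \in M -> #|B| = 2.
  by case/imsetP => i _ ->; rewrite cards2 eq_sym Gn.
have Mm : is_matching M.
  apply/and3P; split=> //; last first.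
    by apply/forallP => B; apply/implyP => /M_card2 ->.
  have := card_uniform_partition M_card2 M_part.
  by rewrite cardsT card_ord; move: #|M| => k kE; apply/eqP; lia.
exists M => // k kN; rewrite -[k]/(val (Ordinal kN)) mate_natE.
by rewrite (@mate_unique M _ (G (Ordinal kN))) //; exact: imset_f.
Qed.

Lemma matching_code_inj M M' : is_matching M -> is_matching M' ->
  matching_code M = matching_code M' -> M = M'.
Proof.
move=> Mm M'm.
have [mI m'I] := (mate_nat_fpf_involution Mm, mate_nat_fpf_involution M'm).
move/(code_of_inj mI m'I) => eqm.
rewrite (matching_mate Mm) (matching_mate M'm); apply: eq_imset => i.
by congr [set i; _]; apply: val_inj; rewrite /= -!mate_natE eqm.
Qed.

Lemma matching_code_surj v : size v = N -> valid v -> stack v = [::] ->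
  exists2 M : {set {set 'I_N}}, is_matching M & matching_code M = v.
Proof.
move=> sz vv sv; have := partner_fpf_involution vv sv; rewrite sz.
case/exists_matching => M Mm mE; exists M => //.
rewrite -[RHS](code_of_partner vv sv) sz; congr rev.
apply/eq_in_map => k; rewrite mem_iota => /andP[_ kN].
by rewrite mE.
Qed.

Lemma in_edges M e : is_matching M ->
  (e \in edges M) = (e.1 < e.2) && (mate M e.1 == e.2).
Proof.
case: e => i j Mm; rewrite inE /=; apply: andb_id2l => ij.
have ji : j != i by rewrite -val_eqE gtn_eqF.
apply/idP/eqP => [/(mate_unique Mm ji)//|<-].
by case: (mateP i Mm).
Qed.

Lemma big_edges_initial (R : Type) (idx : R) (op : Monoid.com_law idx) M
    (P : pred ('I_N * 'I_N)) (F : 'I_N * 'I_N -> R) : is_matching M ->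
  \big[op/idx]_(e in edges M | P e) F e
  = \big[op/idx]_(i : 'I_N | (i < mate M i) && P (i, mate M i))
      F (i, mate M i).
Proof.
move=> Mm; rewrite (reindex_onto (fun i => (i, mate M i)) (fun e => e.1)) /=.
  by apply: eq_bigl => i; rewrite in_edges //= !eqxx !andbT.
by case=> i j; rewrite in_edges //= => /andP[/andP[_ /eqP ->]].
Qed.

Lemma big_edges_terminal (R : Type) (idx : R) (op : Monoid.com_law idx) M
    (F : 'I_N * 'I_N -> R) : is_matching M ->
  \big[op/idx]_(e in edges M) F e
  = \big[op/idx]_(q : 'I_N | mate M q < q) F (mate M q, q).
Proof.
move=> Mm; have := big_edges_initial op predT F Mm.
under eq_bigl do rewrite andbT; move=> ->.
rewrite (reindex_inj (inv_inj (mateK Mm))).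
by apply: eq_big => q; rewrite mateK // ?andbT.
Qed.

Lemma crossings_matching_code M : is_matching M ->
  crossings M = ncross (matching_code M).
Proof.
move=> Mm; rewrite (ncross_code_of (mate_nat_fpf_involution Mm)) //.
pose precross (e f : 'I_N * 'I_N) := [&& e.1 < f.1, f.1 < e.2 & e.2 < f.2].
have precross_asym e f : precross e f -> ~~ precross f e.
  by rewrite /precross; lia.
rewrite -[LHS]/#|[set [set e; f] | e in edges M, f in edges M
                                 & precross e f || precross f e]|.
rewrite card_unordered_pairs // big_edges_terminal //.
apply: eq_big => [q|q _]; first by rewrite mate_natE.
rewrite big_edges_initial // size_filter -sum1_count.
rewrite -[X in iota 0 X]subn0 big_mkord (big_ord_widen_cond N
  (fun b => (mate_nat M q < b) && (q < mate_nat M b)) (fun _ => 1)) 1?ltnW //.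
by apply: eq_bigl => b; rewrite !mate_natE /precross /=; lia.
Qed.

Definition opener M p : 'I_N := if p < mate M p then p else mate M p.

Lemma opener_le M p : opener M p <= p.
Proof. by rewrite /opener; case: (ltnP p (mate M p)). Qed.

Lemma opener_id M p : p < mate M p -> opener M p = p.
Proof. by rewrite /opener => ->. Qed.

Lemma opener_mate M p : is_matching M -> opener M (mate M p) = opener M p.
Proof.
move=> Mm; rewrite /opener mateK //; case: ltngtP => // /val_inj E.
by have [] := mateP p Mm; rewrite E eqxx.
Qed.

Lemma opener_lt M p : is_matching M -> opener M p < mate M (opener M p).
Proof.
move=> Mm; rewrite /opener; case: (ltnP p (mate M p)) => // ge.
rewrite mateK // ltn_neqAle ge andbT.
by have [] := mateP p Mm; rewrite val_eqE.
Qed.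

Lemma opener_cases M p : is_matching M ->
  p = opener M p \/ p = mate M (opener M p).
Proof.
by move=> Mm; rewrite /opener; case: ifP; rewrite ?mateK //; [left | right].
Qed.

Lemma opener_eq_lt M p q : is_matching M -> p < q -> opener M p = opener M q ->
  opener M p = p /\ mate M p = q.
Proof.
move=> Mm pq oE; have [qE|qE] := opener_cases q Mm.
  by have := opener_le M p; rewrite oE -qE leqNgt pq.
have [pE|pE] := opener_cases p Mm; first by rewrite -pE qE -oE -pE.
by rewrite pE qE oE ltnn in pq.
Qed.

Lemma label_at_opener M p : is_matching M ->
  label_at M p = edge_label M (opener M p, mate M (opener M p)).
Proof.
move=> Mm; rewrite /label_at; case: pickP => [[i j]|no] /=.
  rewrite in_edges //= => /andP[/andP[ij /eqP jE] pE]; rewrite -{}jE in ij pE *.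
  suff -> : opener M p = i by [].
  have oi := opener_id ij.
  by case/orP: pE => /eqP->; rewrite ?opener_mate.
have := no (opener M p, mate M (opener M p)).
rewrite in_edges //= opener_lt // eqxx /=.
by case: (opener_cases p Mm) => <-; rewrite eqxx ?orbT.
Qed.

Lemma label_at_lt M p q : is_matching M ->
  (label_at M p < label_at M q) = (opener M p < opener M q).
Proof.
move=> Mm; rewrite !label_at_opener // /edge_label /=.
have mono i j : i <= j ->
    [set e in edges M | e.1 <= i] \subset [set e in edges M | e.1 <= j].
  move=> ij; apply/subsetP => e; rewrite !inE => /andP[-> /=] ei.
  exact: leq_trans ei ij.
have [lt|ge] := ltnP (opener M p) (opener M q); last first.
  by apply/negbTE; rewrite -leqNgt subset_leq_card // mono.
apply/proper_card/properP; split; first exact: mono (ltnW lt).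
exists (opener M q, mate M (opener M q)); rewrite inE in_edges //= opener_lt //.
  by rewrite eqxx /=.
by rewrite eqxx /= -ltnNge.
Qed.

Lemma contains_12312 M : is_matching M ->
  word_contains (canonical_form M) [:: 1; 2; 3; 1; 2] <->
  exists a b c : 'I_N,
    [/\ a < b, b < c, c < mate M a, mate M a < mate M b & c < mate M c].
Proof.
move=> Mm.
have iso_opener t := order_iso_map t _ (fun p q => label_at_lt p q Mm).
split=> [/word_contains_enumP[s]|[a [b [c [ab bc ca m_ab cc]]]]].
  rewrite iso_opener => s_sorted iso.
  have [sz5 _] := order_isoP _ _ iso; rewrite size_map in sz5.
  case: s sz5 s_sorted iso => [|p1 [|p2 [|p3 [|p4 [|p5 [|]]]]]] //= _.
  rewrite andbT order_iso_12312 => /and4P[p12 p23 p34 p45].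
  case/and4P => o12 o23 /eqP/val_inj o41 /eqP/val_inj o52.
  have [p14 p25] : p1 < p4 /\ p2 < p5 by lia.
  have [o1 m1] := opener_eq_lt Mm p14 (esym o41).
  have [o2 m2] := opener_eq_lt Mm p25 (esym o52).
  exists p1, p2, (opener M p3); rewrite m1 m2 opener_lt //; rewrite o2 in o23.
  by split=> //; exact: leq_ltn_trans (opener_le M p3) p34.
have [oa [ob oc]] : opener M a = a /\ opener M b = b /\ opener M c = c.
  by rewrite !opener_id //; lia.
apply/word_contains_enumP; exists [:: a; b; c; mate M a; mate M b].
  by rewrite /= ab bc ca m_ab.
rewrite iso_opener order_iso_12312.
by rewrite !opener_mate // oa ob oc ab bc !eqxx.
Qed.

Lemma avoids_matching_code M : is_matching M ->
  avoids M [:: 1; 2; 3; 1; 2] = avoiding (matching_code M).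
Proof.
move=> Mm.
have avoidP := avoiding_code_of (mate_nat_fpf_involution Mm) (leqnn N).
apply/idP/idP => [no_12312|/avoidP avoid]; last first.
  apply/negP => /(contains_12312 Mm)[a [b [c [ab bc ca m_ab cc]]]].
  have := avoid (mate M a) b c (ltn_ord _).
  by rewrite mem_crossed !mate_natE mateK //; lia.
apply/avoidP => q b c qN; rewrite mem_crossed.
move=> /andP[/andP[+ bq] +] /andP[bc cq]; have [bN cN] : b < N /\ c < N by lia.
rewrite -[q]/(val (Ordinal qN)) -[b]/(val (Ordinal bN)) -[c]/(val (Ordinal cN)).
rewrite !mate_natE => ab qb; rewrite ltnNge leq_eqVlt; apply/negP => cc.
case/negP: no_12312; apply/(contains_12312 Mm).
exists (mate M (Ordinal qN)), (Ordinal bN), (Ordinal cN).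
rewrite mateK //; split=> //.
case/predU1P: cc => // /val_inj E.
by have [] := mateP (Ordinal cN) Mm; rewrite -E eqxx.
Qed.

Lemma card_avoiding_matchings m :
  #|[set M : {set {set 'I_N}} |
       [&& is_matching M, avoids M [:: 1; 2; 3; 1; 2] & crossings M == m]]|
  = count (fun v => (height v == 0) && (ncross v == m)) (avoiding_codes N).
Proof.
set A := [set M | _]; rewrite cardE -size_filter -(size_map matching_code).
apply/perm_size/uniq_perm.
- rewrite map_inj_in_uniq ?enum_uniq // => M M'; rewrite !mem_enum !inE.
  by move=> /andP[Mm _] /andP[M'm _]; exact: matching_code_inj.
- by rewrite filter_uniq // avoiding_codes_uniq.
move=> v; rewrite mem_filter avoiding_codesP; apply/mapP/idP => [[M]|].
  rewrite mem_enum inE => /and3P[Mm]; have mI := mate_nat_fpf_involution Mm.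
  rewrite avoids_matching_code // crossings_matching_code // => aM cM ->.
  rewrite aM cM size_code_of /height (stack_code_of_full mI).
  by rewrite (valid_code_of mI) ?eqxx.
case/andP => /andP[/nilP sv cv] /and3P[/eqP szv vv av].
have [M Mm vE] := matching_code_surj szv vv sv; exists M; last by rewrite vE.
rewrite mem_enum inE Mm avoids_matching_code // vE av.
by rewrite crossings_matching_code // vE.
Qed.

End Matching.

(** * Binomial coefficients *)

Local Open Scope ring_scope.

Lemma coef_Xsub1_exp (R : comNzRingType) (j m : nat) :
  (('X - 1) ^+ j : {poly R})`_m = (-1) ^+ (j + m) * 'C(j, m)%:R.
Proof.
elim: j m => [|j IH] m.
  by rewrite expr0 coef1; case: m => [|m]; rewrite ?mulr0 ?mul1r.
rewrite exprS mulrBl mul1r coefB coefXM; case: m => [|m] /=; rewrite !IH.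
  by rewrite !bin0 !addn0 sub0r exprS mulN1r mulNr.
by rewrite binS natrD !addnS addSn !exprS; ring.
Qed.

(* Coefficient of [y^j] in [(1 - y)^(-k) / k], for [k > 0]. *)
Definition negbin (k j : nat) : rat := 'C(k + j, k)%:R / (k + j)%:R.

(* The binomial of [N] over the true difference [l - j], which is negative for
   [l < j]. *)
Definition bin_diff (N l j : nat) : rat :=
  if (j <= l)%N then 'C(N, l - j)%:R else 0.

Lemma negbinS k j : (0 < k + j)%N ->
  (k + j)%:R * negbin k j = k.+1%:R * negbin k.+1 j.
Proof.
move=> kj0; rewrite /negbin mulrCA divff ?pnatr_eq0 -?lt0n //.
rewrite mulr1 mulrA -natrM -mul_bin_diag addSn natrM mulrAC.
by rewrite divff ?pnatr_eq0 ?mul1r.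
Qed.

Lemma negbin_pred k j :
  (k + j)%:R * (if j is i.+1 then negbin k.+1 i else 0) = j%:R * negbin k.+1 j.
Proof.
case: j => [|i]; first by rewrite mulr0 mul0r.
have := mul_bin_down (k.+1 + i.+1) k.+1; rewrite addKn addnS /= => bin_down.
rewrite /negbin -addSnnS addnS mulrCA divff ?pnatr_eq0 ?addSn // mulr1 mulrA.
by rewrite -natrM -bin_down natrM mulrAC divff ?pnatr_eq0 // mul1r.
Qed.

Lemma bin_diffS N l j :
  bin_diff N.+1 l j = bin_diff N l j + bin_diff N l j.+1.
Proof.
rewrite /bin_diff; case: ltngtP => [jl|lj|->]; rewrite ?addr0 //.
  by rewrite -natrD -(subnSK jl) binS.
by rewrite subnn !bin0.
Qed.

Lemma bin_diffSS N l j : bin_diff N l.+1 j.+1 = bin_diff N l j.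
Proof. by []. Qed.

Lemma mul_bin_diff_left N l j : (l <= N)%N ->
  (l%:R - j%:R) * bin_diff N l j = (N.+1 + j - l)%:R * bin_diff N l j.+1.
Proof.
move=> lN; rewrite /bin_diff; case: ltngtP => [jl|lj|->].
- rewrite -natrB ?(ltnW jl) // -!natrM -(subnSK jl) mul_bin_left.
  by congr (_ * _)%:R; lia.
- by rewrite !mulr0.
by rewrite subrr mul0r mulr0.
Qed.

(** * Counting avoiding codes by crossings *)

Lemma big_fresh_extensions (V : nmodType) (F : nat -> V) (v : code) (h : nat) :
  \sum_(w <- extensions v | (height w == h) && fresh w) F (ncross w)
  = (if (height v).+1 == h then F (ncross v) else 0)
    + (if [&& height v == h.+1, (0 < h)%N & fresh v] then F (ncross v).+1
       else 0).
Proof.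
rewrite big_cons big_map /height /= andbT.
rewrite [X in if _ then _ + X else X](_ : _ =
  if [&& size (stack v) == h.+1, (0 < h)%N & fresh v] then F (ncross v).+1
  else 0); first by case: ifP; rewrite ?add0r.
case: (stack v) (stack_uniq v) => [|t [|u s]] /=.
- by rewrite big_nil.
- by rewrite big_cons big_nil /= eqxx !andbF; case: h.
rewrite inE negb_or => /andP[/andP[tu _] _].
case: (fresh v); rewrite /= ?take0 !big_cons big_nil /= eqxx ?andbF //.
rewrite (negPf tu) eqxx /= !andbT addr0 add1n eqSS.
by case: h => //= h; rewrite andbT.
Qed.

Lemma big_stale_extensions (V : nmodType) (F : nat -> V) (v : code) (h : nat) :
  \sum_(w <- extensions v | (height w == h) && ~~ fresh w) F (ncross w)
  = if height v == h.+1 then F (ncross v) else 0.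
Proof.
rewrite big_cons big_map /height /= andbF.
case: (stack v) (stack_uniq v) => [|t [|u s]] /=; first by rewrite big_nil.
  by rewrite big_cons big_nil /= eqxx andbF andbT addr0 eqSS.
rewrite inE negb_or => /andP[/andP[tu _] _].
case: (fresh v); rewrite /= ?take0 !big_cons big_nil /= eqxx ?andbT ?addr0;
  rewrite ?eqSS //.
by rewrite (negPf tu) /= eqxx andbF addr0.
Qed.

(* The variable is [q - 1], for [q] counting the crossings. *)
Definition crossing_poly (P : pred code) (p h : nat) : {poly rat} :=
  \sum_(v <- avoiding_codes p | (height v == h) && P v) ('X + 1) ^+ ncross v.

Lemma crossing_poly00 : crossing_poly predT 0 0 = 1.
Proof. by rewrite /crossing_poly big_cons big_nil /= expr0 addr0. Qed.

Lemma crossing_poly_fresh0 p : crossing_poly fresh p 0 = 0.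
Proof.
rewrite /crossing_poly; case: p => [|p]; first by rewrite big_cons big_nil.
rewrite /= big_flatten big_map big1 // => v _.
by rewrite (big_fresh_extensions (GRing.exp ('X + 1))) !andbF addr0.
Qed.

Lemma crossing_poly_freshS p h : crossing_poly fresh p.+1 h.+1 =
  crossing_poly predT p h + ('X + 1) * crossing_poly fresh p h.+2.
Proof.
rewrite /crossing_poly /= big_flatten big_map mulr_sumr.
rewrite [X in _ = X + _]big_mkcond [X in _ = _ + X]big_mkcond -big_split.
apply: eq_bigr => v _; rewrite (big_fresh_extensions (GRing.exp ('X + 1))) /=.
by rewrite andbT eqSS -exprS.
Qed.

Lemma crossing_polyS p h : crossing_poly predT p.+1 h =
  crossing_poly fresh p.+1 h + crossing_poly predT p h.+1.
Proof.
rewrite /crossing_poly (bigID fresh) /=; congr (_ + _).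
  by apply: eq_bigl => v; rewrite andbT.
rewrite big_flatten big_map [RHS]big_mkcond; apply: eq_bigr => v _.
rewrite andbT -(big_stale_extensions (GRing.exp ('X + 1))).
by apply: eq_bigl => w; rewrite andbT.
Qed.

Lemma crossing_poly_gt P p h : (p < h)%N -> crossing_poly P p h = 0.
Proof.
move=> ph; rewrite /crossing_poly big_seq_cond big1 // => v.
rewrite avoiding_codesP => /andP[/andP[/eqP sz _] /andP[/eqP hE _]].
by have := height_le_size v; rewrite sz hE leqNgt ph.
Qed.

(* Lagrange inversion, with [k = h + l] opened and [l] closed edges:
   [t^(k-h)] (h + t) (1 + t)^(3k-h) (1 - (q-1) t)^(-k) / k, at (q-1)^j. *)
Definition crossing_coef (h l j : nat) : rat :=
  negbin (h + l) j *
  (h%:R * bin_diff (2 * h + 3 * l) l j + bin_diff (2 * h + 3 * l) l j.+1).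

Definition fresh_crossing_coef (h l j : nat) : rat :=
  negbin (h + l) j * h%:R * bin_diff (2 * h + 3 * l).-1 l j.

Lemma crossing_coefS h l j : crossing_coef h l.+1 j =
  fresh_crossing_coef h l.+1 j + crossing_coef h.+1 l j.
Proof.
rewrite /crossing_coef /fresh_crossing_coef addSnnS.
have -> : (2 * h + 3 * l.+1 = (2 * h.+1 + 3 * l).+1)%N by lia.
by rewrite !bin_diffS !bin_diffSS -[h.+1%:R]natr1 /=; ring.
Qed.

Lemma fresh_crossing_coefS h l j : (0 < h + l)%N ->
  fresh_crossing_coef h.+1 l j =
  crossing_coef h l j
  + negbin (h + l).+1 j * h.+2%:R * bin_diff (2 * h + 3 * l) l j.+1
  + (if j is i.+1 then negbin (h + l).+1 i else 0) * h.+2%:R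
    * bin_diff (2 * h + 3 * l) l j.
Proof.
move=> hl; rewrite /crossing_coef /fresh_crossing_coef addSn.
set N := (2 * h + 3 * l)%N.
have -> : (2 * h.+1 + 3 * l).-1 = N.+1 by rewrite /N; lia.
have kj_neq0 : (h + l + j)%:R != 0 :> rat.
  by rewrite pnatr_eq0 -lt0n addn_gt0 hl.
have lN : (l <= N)%N by rewrite /N; lia.
have NE : (N.+1 + j - l = h + l + j + (h + l).+1)%N by rewrite /N; lia.
move: kj_neq0 (negbinS (ltn_addr j hl)) (negbin_pred (h + l) j).
move: (mul_bin_diff_left j lN); rewrite bin_diffS NE.
move: (negbin (h + l) j) (negbin (h + l).+1 j) (if j is _.+1 then _ else 0).
move: (bin_diff N l j) (bin_diff N l j.+1); rewrite !natrD -!natr1 !natrD.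
move: h%:R l%:R j%:R => H L J x y r0 r r' xy k_neq0 r0E r'E.
apply: (mulfI k_neq0).
transitivity (((H + L + J) * r0) * (H * x + y)
  + (H + L + J) * r * (H + 1 + 1) * y
  + ((H + L + J) * r') * (H + 1 + 1) * x); last by ring.
rewrite r0E r'E; apply/eqP; rewrite -subr_eq0.
rewrite (_ : _ - _ = r * ((L - J) * x - (H + L + J + (H + L + 1)) * y)).
  by rewrite xy subrr mulr0.
by ring.
Qed.

Definition crossing_closed_form (h l : nat) : {poly rat} :=
  \poly_(j < l.+1) crossing_coef h l j.

Definition fresh_closed_form (h l : nat) : {poly rat} :=
  \poly_(j < l.+1) fresh_crossing_coef h l j.

Lemma coef_crossing_closed_form h l j :
  (crossing_closed_form h l)`_j = crossing_coef h l j.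
Proof.
rewrite coef_poly ltnS /crossing_coef /bin_diff; case: (leqP j l) => // lj.
by rewrite ltnNge (ltnW lj) /= mulr0 addr0 mulr0.
Qed.

Lemma coef_fresh_closed_form h l j :
  (fresh_closed_form h l)`_j = fresh_crossing_coef h l j.
Proof.
rewrite coef_poly ltnS /fresh_crossing_coef /bin_diff.
by case: (leqP j l); rewrite ?mulr0.
Qed.

Lemma fresh_closed_form0n l : fresh_closed_form 0 l = 0.
Proof.
apply/polyP => j.
by rewrite coef_fresh_closed_form coef0 /fresh_crossing_coef mulr0 mul0r.
Qed.

Lemma fresh_closed_form10 : fresh_closed_form 1 0 = 1.
Proof.
apply/polyP => j; rewrite coef_fresh_closed_form coef1.
rewrite /fresh_crossing_coef /negbin /bin_diff leqn0.
by case: eqP => [->|]; rewrite ?mulr0 // !bin0 bin1.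
Qed.

Lemma crossing_closed_formS h l : crossing_closed_form h l.+1 =
  fresh_closed_form h l.+1 + crossing_closed_form h.+1 l.
Proof.
apply/polyP => j; rewrite coefD !coef_crossing_closed_form.
by rewrite coef_fresh_closed_form crossing_coefS.
Qed.

Lemma crossing_closed_formn0 h :
  crossing_closed_form h 0 = fresh_closed_form h 0.
Proof.
apply/polyP => j; rewrite coef_crossing_closed_form coef_fresh_closed_form.
rewrite /crossing_coef /fresh_crossing_coef /bin_diff leqn0 /= addr0 mulrA.
by case: eqP => // ->; rewrite !bin0.
Qed.

Lemma fresh_closed_formS h l : (0 < h + l)%N ->
  fresh_closed_form h.+1 l = crossing_closed_form h l
    + ('X + 1) * (if l is l'.+1 then fresh_closed_form h.+2 l' else 0).
Proof.
move=> hl; apply/polyP => j.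
rewrite mulrDl mul1r !coefD coefXM.
rewrite coef_crossing_closed_form coef_fresh_closed_form.
rewrite fresh_crossing_coefS // -addrA [X in _ = _ + X]addrC; congr (_ + _).
case: l hl => [|l] hl.
  by case: j => [|j]; rewrite !coef0 /bin_diff ?mulr0 ?mul0r.
have NE : (2 * h.+2 + 3 * l).-1 = (2 * h + 3 * l.+1)%N by lia.
rewrite coef_fresh_closed_form /fresh_crossing_coef addSnnS addSn -addnS NE.
rewrite bin_diffSS; congr (_ + _); case: j => [|j]; first by rewrite !mul0r.
rewrite coef_fresh_closed_form /fresh_crossing_coef bin_diffSS NE.
by rewrite addSnnS addSn -addnS.
Qed.

Lemma crossing_polyE p h l : p = (h + 2 * l)%N -> (0 < h + l)%N ->
  crossing_poly predT p h = crossing_closed_form h l /\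
  crossing_poly fresh p h = fresh_closed_form h l.
Proof.
elim: p h l => [|p IH] h l pE hl; first by lia.
have freshE : crossing_poly fresh p.+1 h = fresh_closed_form h l.
  case: h pE hl => [|h] pE hl.
    by rewrite crossing_poly_fresh0 fresh_closed_form0n.
  rewrite crossing_poly_freshS; have [hl0|] := posnP (h + l)%N.
    have [-> [-> ->]] : p = 0%N /\ h = 0%N /\ l = 0%N by lia.
    rewrite (crossing_poly_gt fresh) // mulr0 addr0.
    by rewrite crossing_poly00 fresh_closed_form10.
  move=> hl0; rewrite fresh_closed_formS // (IH h l _ hl0).1; last by lia.
  case: l pE hl hl0 => [|l] pE hl hl0.
    by rewrite crossing_poly_gt //; lia.
  by rewrite (IH h.+2 l _ _).2 //; lia.
split=> //; rewrite crossing_polyS freshE; case: l pE hl {freshE} => [|l] pE hl.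
  by rewrite crossing_poly_gt ?crossing_closed_formn0 ?addr0 //; lia.
by rewrite crossing_closed_formS (IH h.+1 l _ _).1 //; lia.
Qed.

Lemma count_height_ncross p h m :
  (count (fun v => (height v == h) && (ncross v == m)) (avoiding_codes p))%:R
  = (crossing_poly predT p h \Po ('X - 1))`_m.
Proof.
rewrite rmorph_sum coef_sum -sum1_count natr_sum big_mkcondr /=.
rewrite [RHS](eq_bigl (fun v => height v == h)) => [|v]; last by rewrite andbT.
apply: eq_bigr => v _; rewrite rmorphXn /= comp_polyD comp_polyX comp_polyC.
by rewrite subrK coefXn [m == _]eq_sym; case: eqP.
Qed.

Lemma coef_crossing_closed_form_comp n m :
  (crossing_closed_form 0 n \Po ('X - 1))`_m =
  \sum_(n <= i < 2 * n)
      (-1) ^+ (n + m + i) / i%:R * 'C(i, n)%:R * 'C(3 * n, i + 1 + n)%:R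
        * 'C(i - n, m)%:R.
Proof.
rewrite /crossing_closed_form poly_def linear_sum coef_sum big_ord_recr /=.
rewrite [X in _ + X](_ : _ = 0) ?addr0; last first.
  rewrite /crossing_coef /bin_diff ltnn mul0r addr0 mulr0 scale0r.
  by rewrite comp_poly0 coef0.
rewrite -[in index_iota n _](add0n n) big_addn.
rewrite (_ : 2 * n - n = n)%N; last by lia.
rewrite big_mkord; apply: eq_bigr => j _; have jn := ltn_ord j.
rewrite comp_polyZ comp_Xn_poly coefZ coef_Xsub1_exp addnK.
rewrite /crossing_coef /negbin /bin_diff jn mul0r muln0 !add0n.
have -> : 'C(3 * n, j + n + 1 + n) = 'C(3 * n, n - j.+1).
  by rewrite -bin_sub; [congr ('C(_, _)) | ]; lia.
have -> : (-1) ^+ (n + m + (j + n)) = (-1) ^+ (j + m) :> rat.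
  have -> : (n + m + (j + n) = (j + m) + n * 2)%N by lia.
  by rewrite exprD exprM sqrr_sign mulr1.
by rewrite [(n + j)%N]addnC; ring.
Qed.

Theorem theorem1 (n m : nat) (hn : (1 <= n)%N) :
  (#|[set M : {set {set 'I_(2 * n)}} |
       [&& is_matching M, avoids M [:: 1; 2; 3; 1; 2]%N & crossings M == m]]|)%:R
  = \sum_(n <= i < 2 * n)
      (-1) ^+ (n + m + i) / i%:R * 'C(i, n)%:R * 'C(3 * n, i + 1 + n)%:R
        * 'C(i - n, m)%:R :> rat.
Proof.
rewrite card_avoiding_matchings count_height_ncross.
by rewrite (@crossing_polyE _ 0 n _ hn).1 ?coef_crossing_closed_form_comp.
Qed.
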